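(* Let $F=|\overline{y}|\sqrt{\phi(z,r)}$ be a Finsler metric defined on $M=\mathbb{R}\times\mathbb{B}^n(\rho)$, where $z=\frac{y^0}{|\overline{y}|}$ and $r=|\overline{x}|$. Put $s=\frac{\langle\overline{x},\overline{y}\rangle}{|\overline{y}|}$, $u=|\overline{y}|$, $$U=\frac{2\phi\phi_{zr}-\phi_z\phi_r}{2r(2\phi\phi_{zz}-\phi_z^2)},\quad V=\frac{\phi_r\phi_{zz}-\phi_z\phi_{zr}}{2r(2\phi\phi_{zz}-\phi_z^2)},\quad W=\frac{\phi_r}{2r(2\phi-z\phi_z)},$$ $$E=U+zV,\qquad H=V+W.$$ Then the Berwald curvature of $F$ is given by $$B^0_{000}=\frac{s}{u}E_{zzz},$$ $$B^0_{00l}=\frac1uE_{zz}x^l-\frac{s}{u^2}\left(E_{zz}+zE_{zzz}\right)y^l,$$ $$B^0_{0kl}=sz\left(zE_{zzz}+3E_{zz}\right)\frac{y^ky^l}{u^3}-zE_{zz}\left(\frac{x^ky^l+x^ly^k}{u^2}\right)-szE_{zz}\frac{\delta^{kl}}{u},$$ $$\begin{aligned}B^0_{jkl}=&\frac{s}{u^4}\left[E-zE_z-2z^2E_{zz}-\tfrac13z^3E_{zzz}\right](y^jy^ky^l)_{\overrightarrow{jkl}}+\frac1{u^3}\left[-E+zE_z+z^2E_{zz}\right](y^jy^kx^l)_{\overrightarrow{jkl}}\\&+\frac1u\left[E-zE_z\right](\delta^{jk}x^l)_{\overrightarrow{jkl}}+\frac{s}{u^2}\left[-E+zE_z+z^2E_{zz}\right](\delta^{jk}y^l)_{\overrightarrow{jkl}},\end{aligned}$$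 $$B^i_{000}=\frac{s}{u^2}H_{zzz}y^i-\frac1uW_{zzz}x^i,$$ $$B^i_{00l}=-\frac{s}{u^3}(2H_{zz}+zH_{zzz})y^iy^l+\frac1{u^2}H_{zz}y^ix^l+\frac{z}{u^2}W_{zzz}y^lx^i+\frac suH_{zz}\delta^{il},$$ $$\begin{aligned}B^i_{0kl}=&\frac{s}{u^4}\left(3H_z+5zH_{zz}+z^2H_{zzz}\right)y^iy^ky^l-\frac{s}{u^2}(H_z+zH_{zz})(\delta^{kl}y^i)_{\overrightarrow{ikl}}\\&-\frac1{u^3}(H_z+zH_{zz})(x^ly^ky^i+x^ky^ly^i)+\frac1uH_z(x^l\delta^{ik}+x^k\delta^{il})\\&+\frac1{u^3}(W_z-zW_{zz}-z^2W_{zzz})x^iy^ky^l-\frac1u(W_z-zW_{zz})x^i\delta^{kl},\end{aligned}$$ $$\begin{aligned}B^i_{jkl}=&\frac{s}{u^5}(-15zH_z-9z^2H_{zz}-z^3H_{zzz})y^iy^jy^ky^l\\&+(3zH_z+z^2H_{zz})\left(\frac1{u^4}y^ix^jy^ky^l+\frac s{u^3}\delta^{ij}y^ky^l+\frac s{u^3}\delta^{jl}y^ky^i\right)_{\overrightarrow{jkl}}\\&-\frac1{u^2}zH_z\left((x^jy^i+us\,\delta^{ij})\delta^{kl}+(x^j\delta^{ik}+x^k\delta^{ij})y^l\right)_{\overrightarrow{jkl}}\\&-\frac1{u^4}(3zW_z-3z^2W_{zz}-z^3W_{zzz})x^iy^jy^ky^l+\frac z{u^2}(W_z-zW_{zz})x^i(y^j\delta^{kl})_{\overrightarrow{jkl}},\end{aligned}$$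 for all $i,j,k,l\in\{1,\dots,n\}$.
   Context: Let $n\ge 2$, let $\mathbb{B}^n(\rho)\subset\mathbb{R}^n$ be the open ball of radius $\rho$ centred at the origin, and $M=\mathbb{R}\times\mathbb{B}^n(\rho)$ (so $\dim M=n+1$), with coordinates $x=(x^0,\overline{x})$, $\overline{x}=(x^1,\dots,x^n)$ and tangent coordinates $y=(y^0,\overline{y})$, $\overline{y}=(y^1,\dots,y^n)$; $|\cdot|$, $\langle\cdot,\cdot\rangle$ are the Euclidean norm and inner product on $\mathbb{R}^n$. Capital indices run over $0,\dots,n$, lower case indices over $1,\dots,n$; subscripts $z,r$ denote partial derivatives. A Finsler metric on $M$ is a function $F:TM\to[0,\infty)$ that is $C^\infty$ on $TM\setminus\{0\}$ and restricts to a Minkowski norm on each tangent space. The metrics considered have the form $F=|\overline{y}|\sqrt{\phi(z,r)}$ with $\phi$ a differentiable function of $z$ and $r$; formulas are read at points with $\overline{y}\neq0$, $\overline{x}\neq0$. The notation $(\cdot)_{\overrightarrow{jkl}}$ means the sum of the expression over the three cyclic permutations of the indices $j,k,l$ (so $(y^jy^ky^l)_{\overrightarrow{jkl}}=3y^jy^ky^l$), and similarly for $\overrightarrow{ikl}$. With $g_{AB}=\frac12[F^2]_{y^Ay^B}$, the spray coefficients are $G^C=\frac14 g^{CA}\left([F^2]_{y^Ax^B}y^B-[F^2]_{x^A}\right)$ (sum over repeated indices), and the Berwald curvature is $B^A_{BCD}=\frac{\partial^3G^A}{\partial y^B\partial y^C\partial y^D}$. *)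

(* Defs.v *)
From HB Require Import structures.
From mathcomp Require Import all_boot all_order all_algebra.
From mathcomp Require Import all_classical all_reals all_analysis.

Set Implicit Arguments.
Unset Strict Implicit.
Unset Printing Implicit Defensive.

Import Order.TTheory GRing.Theory Num.Theory.
Import numFieldNormedType.Exports.

Local Open Scope classical_set_scope.
Local Open Scope ring_scope.

(* The norm of the normed module 'rV[R]_m is the max norm, so the Euclidean
   inner product and norm are introduced here. *)
Definition edot {R : realType} {m : nat} (v w : 'rV[R]_m) : R :=
  \sum_(i < m) v 0 i * w 0 i.

Definition enorm {R : realType} {m : nat} (v : 'rV[R]_m) : R :=
  Num.sqrt (edot v v).

(* v = (v^0, v^1, ..., v^n) |-> (v^1, ..., v^n); the lower case index i in
   {1, ..., n} is represented by i : 'I_n, seen in {0, ..., n} as lift ord0 i. *)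
Definition spat {R : realType} {n : nat} (v : 'rV[R]_n.+1) : 'rV[R]_n :=
  \row_(i < n) v 0 (lift ord0 i).

Definition cylinder {R : realType} (n : nat) (rho : R) : set 'rV[R]_n.+1 :=
  [set x | enorm (spat x) < rho].

(* C^k and C^oo on an open subset U of a finite-dimensional space; derivatives
   of order k.+1 are all the derivatives of order k of the 'D_v f. *)
Fixpoint Ck_on {R : realType} {V : normedModType R} (k : nat) (U : set V)
    (f : V -> R) : Prop :=
  match k with
  | 0%N => forall x, U x -> {for x, continuous f}
  | k'.+1 => (forall x, U x -> differentiable f x) /\
             (forall v : V, Ck_on k' U ('D_v f))
  end.

Definition smooth_on {R : realType} {V : normedModType R} (U : set V)
    (f : V -> R) : Prop := forall k, Ck_on k U f.

Definition pder {R : realType} {m : nat} (A : 'I_m) (f : 'rV[R]_m -> R) :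
    'rV[R]_m -> R := 'D_(delta_mx 0 A) f.

Definition fundamental_tensor {R : realType} {m : nat} (N : 'rV[R]_m -> R)
    (y : 'rV[R]_m) : 'M[R]_m :=
  \matrix_(A, B) (2^-1 * pder B (pder A (fun w => N w ^+ 2)) y).

Definition minkowski_norm {R : realType} {m : nat} (N : 'rV[R]_m -> R) : Prop :=
  [/\ forall y : 'rV[R]_m, 0 <= N y,
      smooth_on [set y : 'rV[R]_m | y != 0] N,
      forall (a : R) (y : 'rV[R]_m), 0 < a -> N (a *: y) = a * N y
    & forall y v : 'rV[R]_m, y != 0 -> v != 0 ->
        0 < (v *m fundamental_tensor N y *m v^T) 0 0].

(* The tangent bundle of an open subset M of R^m is M x R^m; F is a total
   function of (x, y) which is only constrained for x in M. *)
Definition finsler_metric {R : realType} {m : nat} (M : set 'rV[R]_m)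
    (F : 'rV[R]_m -> 'rV[R]_m -> R) : Prop :=
  smooth_on [set p : 'rV[R]_m * 'rV[R]_m | M p.1 /\ p.2 != 0]
    (fun p => F p.1 p.2) /\
  (forall x, M x -> minkowski_norm (F x)).

Definition dX {R : realType} {m : nat} (A : 'I_m)
    (f : 'rV[R]_m -> 'rV[R]_m -> R) : 'rV[R]_m -> 'rV[R]_m -> R :=
  fun x y => pder A (fun x' => f x' y) x.

Definition dY {R : realType} {m : nat} (A : 'I_m)
    (f : 'rV[R]_m -> 'rV[R]_m -> R) : 'rV[R]_m -> 'rV[R]_m -> R :=
  fun x y => pder A (f x) y.

Definition spray {R : realType} {m : nat} (F : 'rV[R]_m -> 'rV[R]_m -> R)
    (C : 'I_m) : 'rV[R]_m -> 'rV[R]_m -> R :=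
  let F2 := fun x y => F x y ^+ 2 in
  fun x y => 4^-1 * \sum_(A < m) invmx (fundamental_tensor (F x) y) C A *
    ((\sum_(B < m) dX B (dY A F2) x y * y 0 B) - dX A F2 x y).

Definition berwald {R : realType} {m : nat} (F : 'rV[R]_m -> 'rV[R]_m -> R)
    (A B C D : 'I_m) : 'rV[R]_m -> 'rV[R]_m -> R :=
  dY D (dY C (dY B (spray F A))).

(* Partial derivatives of a function of (z, r). *)
Definition dz {R : realType} (f : R -> R -> R) : R -> R -> R :=
  fun z r => derive1 (fun z' => f z' r) z.

Definition dr {R : realType} (f : R -> R -> R) : R -> R -> R :=
  fun z r => derive1 (f z) r.

Definition funU {R : realType} (phi : R -> R -> R) : R -> R -> R := fun z r =>
  (2 * phi z r * dr (dz phi) z r - dz phi z r * dr phi z r) /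
  (2 * r * (2 * phi z r * dz (dz phi) z r - dz phi z r ^+ 2)).

Definition funV {R : realType} (phi : R -> R -> R) : R -> R -> R := fun z r =>
  (dr phi z r * dz (dz phi) z r - dz phi z r * dr (dz phi) z r) /
  (2 * r * (2 * phi z r * dz (dz phi) z r - dz phi z r ^+ 2)).

Definition funW {R : realType} (phi : R -> R -> R) : R -> R -> R := fun z r =>
  dr phi z r / (2 * r * (2 * phi z r - z * dz phi z r)).

Definition funE {R : realType} (phi : R -> R -> R) : R -> R -> R := fun z r =>
  funU phi z r + z * funV phi z r.

Definition funH {R : realType} (phi : R -> R -> R) : R -> R -> R := fun z r =>
  funV phi z r + funW phi z r.

Definition cyc {R : realType} {I : Type} (f : I -> I -> I -> R) (j k l : I) : R :=
  f j k l + f k l j + f l j k.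

Definition kron {R : realType} {n : nat} (i j : 'I_n) : R := (i == j)%:R.

(* Main.v *)
Require Import Defs.
From HB Require Import structures.
From mathcomp Require Import all_boot all_order all_algebra.
From mathcomp Require Import all_classical all_reals all_analysis.
From mathcomp Require Import ring lra.

Set Implicit Arguments.
Unset Strict Implicit.
Unset Printing Implicit Defensive.

Import Order.TTheory GRing.Theory Num.Theory.
Import numFieldNormedType.Exports.

Local Open Scope ring_scope.

(** The metric depends on y only through u = |y-bar| and the slope z = y^0/u,
and on x only through r = |x-bar|, so everything reduces to calculus in z and r.

The spray. Write f for phi at the fixed radius r and, for a direction v, let
Zv = v^0 - z <y-bar, v-bar> / u, so that the derivative of z along v is Zv / u.
Then the Hessian of F^2 = u^2 f(z) is
  (2f - z f') <v,w> + f'' Zv Zw + (f'/u) (<y,v> Zw + <y,w> Zv)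
    + (z f'/u^2) <y,v> <y,w>                    ([jet2_energy], [hessian]).
The fundamental tensor g is half of it, hence the linear system
  4 g G = (y^B d_{x^B} d_{y^A} F^2 - d_{x^A} F^2)_A
can be checked directly on the candidate
  G^0 = <x,y> u E(z),      G^i = <x,y> H(z) y^i - u^2 W(z) x^i,
and g is invertible because it is positive definite ([sprayE]).

Nondegeneracy. The denominators of U, V, W are 2r times 2f - z f' and
2 f f'' - f'^2.  They are positive because, at the tangent vector (z, e_1), the
first is the value of the Hessian on a unit vector e_2 orthogonal to e_1 (this
is where n >= 2 enters) and the second is, up to the positive factor f'', its
value on a well chosen vector of the plane of e_0 and e_1
([spherical_nondegenerate]).  The same inequalities give f > 0, so that the
square root in F is a genuine one.

Smoothness. For 0 < r < rho one has phi(z, r) = F(r e_1, (z, e_1))^2, so phi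
inherits smoothness along z from F, and so do phi_r and phi_zr; E, H and W are
built from these three by derivatives in z and field operations
([derivable_upto_funEHW]).

The Berwald curvature. The coefficients G^A are products of linear functions of
y, of u and of functions of z.  Their third derivatives follow from the Leibniz
rule and the chain rule, which are packaged as an algebra of 3-jets: a function
with its first three iterated directional derivatives ([jet]).  The formulas of
the theorem are these jets in coordinate directions, and comparing both sides is
an identity of rational functions ([berwald_spherical]). *)

(** * Directional derivatives of scalar functions *)

Section DirectionalDerivatives.
Variables (R : realType) (V : normedModType R).
Implicit Types (f g : V -> R) (x v : V).

(** The difference quotient of f along v is that of its restriction to any curve
c with constant increment v; with c an affine line this turns statements about
functions on V into statements about functions of one real variable. *)
Lemma is_derive_alongP f (c : R -> V) t v df :
  (forall h, c (h + t) = h *: v + c t) ->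
  is_derive t 1 (f \o c) df <-> is_derive (c t) v f df.
Proof.
move=> hc.
have E : (fun h : R => h^-1 *: (((f \o c) \o shift t) (h *: 1) - (f \o c) t))
       = (fun h => h^-1 *: ((f \o shift (c t)) (h *: v) - f (c t))).
  by apply/funext => h; rewrite /= [h *: 1]mulr1 hc.
by split=> -[d1 d2]; split; move: d1 d2; rewrite /derivable /derive E.
Qed.

Lemma is_derive_cstl (k : R) x v : is_derive x v (fun=> k) 0.
Proof. exact: is_derive_cst. Qed.

Lemma is_derive_add f g x v df dg : is_derive x v f df -> is_derive x v g dg ->
  is_derive x v (fun y => f y + g y) (df + dg).
Proof. exact: is_deriveD. Qed.

Lemma is_derive_opp f x v df : is_derive x v f df ->
  is_derive x v (fun y => - f y) (- df).
Proof. exact: is_deriveN. Qed.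

Lemma is_derive_mul f g x v df dg : is_derive x v f df -> is_derive x v g dg ->
  is_derive x v (fun y => f y * g y) (df * g x + f x * dg).
Proof.
by move=> hf hg; apply: is_derive_eq (is_deriveM hf hg) _; rewrite addrC mulrC.
Qed.

Lemma is_derive_exp f (k : nat) x v df : is_derive x v f df ->
  is_derive x v (fun y => f y ^+ k) (k%:R * f x ^+ k.-1 * df).
Proof.
move=> hf; have -> : (fun y => f y ^+ k) = f ^+ k.
  by apply/funext => y; rewrite exprfctE.
exact: is_deriveX.
Qed.

Lemma is_derive_inv f x v df : f x != 0 -> is_derive x v f df ->
  is_derive x v (fun y => (f y)^-1) (- (df / f x ^+ 2)).
Proof.
move=> fx0 [d1 d2]; split; first exact: derivableV.
by rewrite deriveV// d2 -[LHS]/(_ * _) mulNr mulrC.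
Qed.

Lemma is_derive_comp (g : R -> R) f x v dg df :
  is_derive (f x) 1 g dg -> is_derive x v f df ->
  is_derive x v (fun y => g (f y)) (dg * df).
Proof.
move=> hg hf; pose c (h : R) : V := h *: v + x.
have c0 : c 0 = x by rewrite /c scale0r add0r.
have hc h : c (h + 0) = h *: v + c 0 by rewrite c0 addr0.
rewrite -{}c0 in hg hf *.
apply/(is_derive_alongP _ _ hc)/is_derive1_comp => //.
exact/is_derive_alongP.
Qed.

End DirectionalDerivatives.

(** Syntax-directed differentiation: the derivative is left as an evar which the
rules fill in, and the leaves are closed by hypotheses on the atoms. Constants
come first so that they are not decomposed by the other rules. *)
Ltac derive_rules :=
  lazymatch goal with
  | |- is_derive _ _ (fun=> ?k) _ => eapply is_derive_cstl
  | |- is_derive _ _ (fun y => @?f y + @?g y) _ =>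
      eapply (@is_derive_add _ _ f g); derive_rules
  | |- is_derive _ _ (fun y => - @?f y) _ =>
      eapply (@is_derive_opp _ _ f); derive_rules
  | |- is_derive _ _ (fun y => @?f y * @?g y) _ =>
      eapply (@is_derive_mul _ _ f g); derive_rules
  | |- is_derive _ _ (fun y => @?f y ^+ ?k) _ =>
      eapply (@is_derive_exp _ _ f k); derive_rules
  | |- is_derive _ _ (fun y => (@?f y)^-1) _ =>
      eapply (@is_derive_inv _ _ f); [|derive_rules]
  | |- is_derive _ _ (fun y => y) _ => exact: is_derive_id
  | |- _ => eauto
  end.

(** * Third-order directional jets *)

(** [jet0] is a function and [jet1 v], [jet2 v w], [jet3 v w t] are its iterated
derivatives along v, then w, then t, as functions of the base point. Keeping the
directions abstract makes one computation serve every coordinate derivative. *)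
Record jet (R : realType) (V : normedModType R) := Jet {
  jet0 : V -> R;
  jet1 : V -> V -> R;
  jet2 : V -> V -> V -> R;
  jet3 : V -> V -> V -> V -> R }.

Section Jets.
Variables (R : realType) (V : normedModType R).
Implicit Types (a b : jet V) (U : set V).

Definition is_jet U a : Prop := forall y, U y ->
  [/\ forall v, is_derive y v (jet0 a) (jet1 a v y),
      forall v w, is_derive y w (jet1 a v) (jet2 a v w y)
    & forall v w t, is_derive y t (jet2 a v w) (jet3 a v w t y)].

Definition jet_mul a b : jet V := Jet
  (fun y => jet0 a y * jet0 b y)
  (fun v y => jet1 a v y * jet0 b y + jet0 a y * jet1 b v y)
  (fun v w y => jet2 a v w y * jet0 b y + jet1 a v y * jet1 b w y
              + (jet1 a w y * jet1 b v y + jet0 a y * jet2 b v w y))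
  (fun v w t y =>
     jet3 a v w t y * jet0 b y + jet2 a v w y * jet1 b t y
   + (jet2 a v t y * jet1 b w y + jet1 a v y * jet2 b w t y)
   + (jet2 a w t y * jet1 b v y + jet1 a w y * jet2 b v t y
   + (jet1 a t y * jet2 b v w y + jet0 a y * jet3 b v w t y))).

Definition jet_sub a b : jet V := Jet
  (fun y => jet0 a y - jet0 b y) (fun v y => jet1 a v y - jet1 b v y)
  (fun v w y => jet2 a v w y - jet2 b v w y)
  (fun v w t y => jet3 a v w t y - jet3 b v w t y).

Definition jet_cst (k : R) : jet V := Jet
  (fun=> k) (fun _ _ => 0) (fun _ _ _ => 0) (fun _ _ _ _ => 0).

Definition jet_lin (f : V -> R) : jet V := Jet
  f (fun v _ => f v) (fun _ _ _ => 0) (fun _ _ _ _ => 0).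

(** The jet of y |-> f (a y) r. The second argument of f is carried along as a
parameter so that the derivatives of f appear as iterated [dz]. *)
Definition jet_comp (f : R -> R -> R) (r : R) a : jet V :=
  let f1 := dz f in let f2 := dz f1 in let f3 := dz f2 in Jet
  (fun y => f (jet0 a y) r)
  (fun v y => f1 (jet0 a y) r * jet1 a v y)
  (fun v w y => f2 (jet0 a y) r * jet1 a w y * jet1 a v y
              + f1 (jet0 a y) r * jet2 a v w y)
  (fun v w t y =>
     (f3 (jet0 a y) r * jet1 a t y * jet1 a w y
      + f2 (jet0 a y) r * jet2 a w t y) * jet1 a v y
   + f2 (jet0 a y) r * jet1 a w y * jet2 a v t y
   + (f2 (jet0 a y) r * jet1 a t y * jet2 a v w y
      + f1 (jet0 a y) r * jet3 a v w t y)).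

Lemma is_jet_mul U a b : is_jet U a -> is_jet U b -> is_jet U (jet_mul a b).
Proof.
move=> ha hb y Uy; have [a1 a2 a3] := ha y Uy; have [b1 b2 b3] := hb y Uy.
by split=> *; rewrite /=; derive_rules.
Qed.

Lemma is_jet_sub U a b : is_jet U a -> is_jet U b -> is_jet U (jet_sub a b).
Proof.
move=> ha hb y Uy; have [a1 a2 a3] := ha y Uy; have [b1 b2 b3] := hb y Uy.
by split=> *; rewrite /=; derive_rules.
Qed.

Lemma is_jet_cst U k : is_jet U (jet_cst k).
Proof. by move=> y _; split=> *; apply: is_derive_cstl. Qed.

Lemma is_jet_lin U (f : V -> R) : (forall y v, is_derive y v f (f v)) ->
  is_jet U (jet_lin f).
Proof. by move=> hf y _; split=> *; rewrite /=; [|apply: is_derive_cstl..]. Qed.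

(** k-fold differentiability on the whole line, which is the domain of the
slope z. *)
Fixpoint derivable_upto (k : nat) (g : R -> R) : Prop :=
  if k is k'.+1 then
    (forall t, derivable g t 1) /\ derivable_upto k' (derive1 g)
  else True.

Lemma is_jet_comp U f r a : derivable_upto 3 (f ^~ r) -> is_jet U a ->
  is_jet U (jet_comp f r a).
Proof.
case=> f1 [f2 [f3 _]] ha y Uy; have [a1 a2 a3] := ha y Uy.
have D (g : R -> R -> R) v : (forall t, derivable (g ^~ r) t 1) ->
    is_derive y v (fun y => g (jet0 a y) r) (dz g (jet0 a y) r * jet1 a v y).
  move=> dg; apply: (is_derive_comp (g := g ^~ r)) => //.
  by rewrite /dz derive1E; apply: derivableP.
have {}f1 v := D _ v f1; have {}f2 v := D (dz f) v f2.
have {}f3 v := D (dz (dz f)) v f3.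
by split=> *; rewrite /=; derive_rules.
Qed.

End Jets.

(** On an open set a jet computes the iterated partial derivatives of any
function that agrees there with its value: each derivative depends only on
nearby values, so the agreement propagates from one order to the next. *)
Lemma is_jet_pder (R : realType) (m : nat) (U : set 'rV[R]_m) (a : jet 'rV[R]_m)
    (f : 'rV[R]_m -> R) (B C D : 'I_m) y :
  open U -> is_jet U a -> (forall y, U y -> f y = jet0 a y) -> U y ->
  [/\ pder B f y = jet1 a (delta_mx 0 B) y,
      pder C (pder B f) y = jet2 a (delta_mx 0 B) (delta_mx 0 C) y
    & pder D (pder C (pder B f)) y =
      jet3 a (delta_mx 0 B) (delta_mx 0 C) (delta_mx 0 D) y].
Proof.
move=> oU ha hf Uy.
have ext (g h : 'rV[R]_m -> R) (w : 'rV[R]_m) z d :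
    (forall y, U y -> g y = h y) -> U z -> is_derive z w h d -> 'D_w g z = d.
  move=> gh Uz hd; apply: derive_val; apply: near_eq_is_derive hd.
  by near=> t; rewrite gh//; near: t; apply: open_nbhs_nbhs.
have p1 z : U z -> pder B f z = jet1 a (delta_mx 0 B) z.
  by move=> Uz; apply: (ext _ _ _ _ _ hf Uz); have [] := ha z Uz.
have p2 z : U z ->
    pder C (pder B f) z = jet2 a (delta_mx 0 B) (delta_mx 0 C) z.
  by move=> Uz; apply: (ext _ _ _ _ _ p1 Uz); have [] := ha z Uz.
split; [exact: p1|exact: p2|].
by apply: (ext _ _ _ _ _ p2 Uy); have [] := ha y Uy.
Unshelve. all: by end_near. Qed.

(** * Euclidean geometry of the spatial part *)

Section Euclidean.
Variable R : realType.

Section Edot.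
Variable m : nat.
Implicit Types v w : 'rV[R]_m.

Lemma edotC v w : edot v w = edot w v.
Proof. by apply: eq_bigr => i _; rewrite mulrC. Qed.

Lemma edot_linear v (a : R) w w' :
  edot v (a *: w + w') = a * edot v w + edot v w'.
Proof.
rewrite /edot mulr_sumr -big_split; apply: eq_bigr => i _ /=.
by rewrite !mxE mulrDr mulrCA.
Qed.

Lemma edot_ge0 v : 0 <= edot v v.
Proof. by apply: sumr_ge0 => i _; rewrite -expr2 sqr_ge0. Qed.

Lemma edot_gt0 v : v != 0 -> 0 < edot v v.
Proof.
move=> v0; rewrite lt0r edot_ge0 andbT; apply: contra v0 => /eqP v0.
apply/eqP/rowP => i; rewrite mxE; apply/eqP; rewrite -sqrf_eq0 expr2.
apply/eqP; move: i isT; apply/psumr_eq0P => [j _|//].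
by rewrite -expr2 sqr_ge0.
Qed.

Lemma enorm_gt0 v : v != 0 -> 0 < enorm v.
Proof. by move=> v0; rewrite sqrtr_gt0 edot_gt0. Qed.

Lemma enorm_gt0P v : 0 < enorm v -> v != 0.
Proof.
apply: contraTneq => ->; rewrite /enorm /edot big1 ?sqrtr0 ?ltxx// => i _.
by rewrite mxE mul0r.
Qed.

Lemma sqr_enorm v : enorm v ^+ 2 = edot v v.
Proof. by rewrite sqr_sqrtr ?edot_ge0. Qed.

(** Sums over coordinate directions, as in g_AB G^B or y^B d_B, are values of a
linear form on the vector of coefficients. *)
Lemma linear_form_sum (L : 'rV[R]_m -> R) v :
  (forall (a : R) v w, L (a *: v + w) = a * L v + L w) ->
  L v = \sum_(B < m) v 0 B * L (delta_mx 0 B).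
Proof.
move=> LL.
have L0 : L 0 = 0 by have := LL (-1) 0 0; rewrite scaler0 addr0; lra.
rewrite {1}[v]row_sum_delta.
elim/big_rec2: _ => [|B a w _ <-]; first by rewrite L0.
by rewrite LL.
Qed.

End Edot.

Section Spat.
Variable n : nat.
Implicit Types (x y v w : 'rV[R]_n.+1) (p : 'rV[R]_n).

Lemma spat_linear (a : R) v w : spat (a *: v + w) = a *: spat v + spat w.
Proof. by apply/rowP => i; rewrite !mxE. Qed.

Lemma edot_spat_linear p (a : R) v w :
  edot p (spat (a *: v + w)) = a * edot p (spat v) + edot p (spat w).
Proof. by rewrite spat_linear edot_linear. Qed.

Lemma edot_spat_time p : edot p (spat (delta_mx 0 ord0)) = 0.
Proof. by rewrite /edot big1// => i _; rewrite !mxE mulr0. Qed.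

Lemma edot_spat_space p i : edot p (spat (delta_mx 0 (lift ord0 i))) = p 0 i.
Proof.
rewrite /edot (bigD1 i)//= !mxE !eqxx mulr1 big1 ?addr0// => j ji.
by rewrite !mxE eqxx (inj_eq lift_inj) (negbTE ji) mulr0.
Qed.

Lemma is_derive_linear (f : 'rV[R]_n.+1 -> R) y v :
  (forall (a : R) v w, f (a *: v + w) = a * f v + f w) ->
  is_derive y v f (f v).
Proof.
move=> fL; pose c (h : R) := h *: v + y.
have c0 : c 0 = y by rewrite /c scale0r add0r.
rewrite -[y in is_derive y]c0; apply/is_derive_alongP => [h|].
  by rewrite c0 addr0.
rewrite (_ : f \o c = fun h => h * f v + f y); last first.
  by apply/funext => h; rewrite /= fL.
eapply is_derive_eq; first by derive_rules.
by rewrite mul1r mulr0 !addr0.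
Qed.

Lemma is_derive_edot_spat p y v :
  is_derive y v (fun y => edot p (spat y)) (edot p (spat v)).
Proof. by apply: is_derive_linear => *; exact: edot_spat_linear. Qed.

Lemma is_derive_coord A y v :
  is_derive y v (fun y : 'rV[R]_n.+1 => y 0 A) (v 0 A).
Proof. by apply: is_derive_linear => *; rewrite !mxE. Qed.

(** Along a line |y + h v|^2 is a quadratic polynomial in h. *)
Lemma is_derive_sqr_enorm_spat y v :
  is_derive y v (fun y => edot (spat y) (spat y)) (2 * edot (spat y) (spat v)).
Proof.
pose c (h : R) := h *: v + y.
have c0 : c 0 = y by rewrite /c scale0r add0r.
rewrite -[y in is_derive y]c0; apply/is_derive_alongP => [h|].
  by rewrite c0 addr0.
rewrite (_ : _ \o c = fun h => h * h * edot (spat v) (spat v)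
  + h * (2 * edot (spat y) (spat v)) + edot (spat y) (spat y)); last first.
  apply/funext => h; rewrite /= edot_spat_linear ![edot (spat (c h)) _]edotC.
  by rewrite !edot_spat_linear [edot (spat v) (spat y)]edotC; ring.
eapply is_derive_eq; first by derive_rules.
by ring.
Qed.

Lemma is_derive_enorm_spat y v : spat y != 0 ->
  is_derive y v (fun y => enorm (spat y))
    (edot (spat y) (spat v) / enorm (spat y)).
Proof.
move=> y0; have u0 := enorm_gt0 y0.
have sqrtD := is_derive1_sqrt (edot_gt0 y0).
have D := is_derive_comp (f := fun y => edot (spat y) (spat y)) sqrtD
  (is_derive_sqr_enorm_spat y v).
by apply: (is_derive_eq D); rewrite -/(enorm _); field; rewrite gt_eqF.
Qed.

Lemma continuous_enorm_spat :
  continuous (fun y : 'rV[R]_n.+1 => enorm (spat y)).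
Proof.
move=> y; apply: (@continuous_comp _ _ _ (fun y => edot (spat y) (spat y))
  Num.sqrt); last exact: sqrt_continuous.
rewrite (_ : (fun y => _) = \sum_(i < n)
  ((fun y : 'rV[R]_n.+1 => y 0 (lift ord0 i) : R)
    * (fun y => y 0 (lift ord0 i)))); last first.
  by apply/funext => v; rewrite fct_sumE; apply: eq_bigr => i _; rewrite !mxE.
apply: differentiable_continuous; apply: differentiable_sum => i.
by apply: differentiableM; exact: differentiable_coord.
Qed.

Lemma open_spat_neq0 : open [set y : 'rV[R]_n.+1 | spat y != 0]%classic.
Proof.
rewrite (_ : mkset _ = (fun y => enorm (spat y)) @^-1` [set t | 0 < t])%classic.
  apply: open_comp; last exact: open_gt.
  by move=> y _; exact: continuous_enorm_spat.
by apply/seteqP; split=> y /=; [exact: enorm_gt0|exact: enorm_gt0P].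
Qed.

Lemma open_cylinder rho : open (@cylinder R n rho).
Proof.
rewrite (_ : cylinder _ =
  (fun y => enorm (spat y)) @^-1` [set t | t < rho])%classic//.
by apply: open_comp; [move=> y _; exact: continuous_enorm_spat|exact: open_lt].
Qed.

End Spat.
End Euclidean.

(** * Jets of the energy and of the spray coefficients *)

Section SprayJets.
Variables (R : realType) (n : nat).
Local Notation V := 'rV[R]_n.+1.
Implicit Types (y v w t : V) (p : 'rV[R]_n).

(** The complement of the axis u = 0, on which the slope is not defined. *)
Definition nonvertical : set V := [set y | spat y != 0]%classic.

Definition slope y : R := y 0 ord0 / enorm (spat y).

Definition jet_edot p : jet V := jet_lin (fun y => edot p (spat y)).

Definition jet_coord A : jet V := jet_lin (fun y : V => y 0 A).

Local Notation dot v w := (edot (spat v) (spat w)).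
Local Notation nrm y := (enorm (spat y)).

Definition jet_norm : jet V := Jet
  (fun y => nrm y)
  (fun v y => dot y v / nrm y)
  (fun v w y => dot v w / nrm y - dot y v * dot y w / nrm y ^+ 3)
  (fun v w t y =>
     3 * (dot y v * dot y w * dot y t) / nrm y ^+ 5
     - (dot v w * dot y t + dot v t * dot y w + dot w t * dot y v)
       / nrm y ^+ 3).

(** The derivative of the slope along v is Zv / u with
Zv = v^0 - z <y,v> / u; the higher orders follow from those of u. *)
Definition jet_slope : jet V := Jet slope
  (fun v y => (v 0 ord0 - slope y * (dot y v / nrm y)) / nrm y)
  (fun v w y => 3 * slope y * (dot y v * dot y w) / nrm y ^+ 4
     - slope y * dot v w / nrm y ^+ 2
     - (v 0 ord0 * dot y w + w 0 ord0 * dot y v) / nrm y ^+ 3)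
  (fun v w t y =>
     3 * (v 0 ord0 * (dot y w * dot y t) + w 0 ord0 * (dot y v * dot y t)
          + t 0 ord0 * (dot y v * dot y w)) / nrm y ^+ 5
     - (v 0 ord0 * dot w t + w 0 ord0 * dot v t + t 0 ord0 * dot v w)
       / nrm y ^+ 3
     + 3 * slope y * (dot v t * dot y w + dot w t * dot y v + dot v w * dot y t)
       / nrm y ^+ 4
     - 15 * slope y * (dot y v * dot y w * dot y t) / nrm y ^+ 6).

Lemma is_derive_dotl y v w : is_derive y w (fun y => dot y v) (dot w v).
Proof.
rewrite edotC; under eq_fun do rewrite edotC.
exact: is_derive_edot_spat.
Qed.

Lemma is_jet_edot U p : is_jet U (jet_edot p).
Proof. by apply: is_jet_lin => *; exact: is_derive_edot_spat. Qed.

Lemma is_jet_coord U A : is_jet U (jet_coord A).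
Proof. by apply: is_jet_lin => *; exact: is_derive_coord. Qed.

Lemma is_jet_norm : is_jet nonvertical jet_norm.
Proof.
move=> y y0; have u0 : nrm y != 0 by rewrite gt_eqF ?enorm_gt0.
have Du v := is_derive_enorm_spat v y0; have Dv v w := is_derive_dotl y v w.
split=> [//|v w|v w t] /=; eapply is_derive_eq; derive_rules;
  rewrite /= ?expf_neq0//.
  by rewrite (edotC (spat w)); field.
by rewrite (edotC (spat t) (spat v)) (edotC (spat t) (spat w)); field.
Qed.

Lemma is_jet_slope : is_jet nonvertical jet_slope.
Proof.
move=> y y0; have u0 : nrm y != 0 by rewrite gt_eqF ?enorm_gt0.
have Du v := is_derive_enorm_spat v y0; have Dv v w := is_derive_dotl y v w.
have D0 w := is_derive_coord ord0 y w.
rewrite /jet_slope /slope.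
split=> [v|v w|v w t] /=; eapply is_derive_eq; derive_rules;
  rewrite /= ?expf_neq0//.
- by field.
- by rewrite (edotC (spat w)); field.
- by rewrite (edotC (spat t) (spat v)) (edotC (spat t) (spat w)); field.
Qed.

(** The jet of F^2 when F^2 = u^2 f(z, r). *)
Definition jet_energy (f : R -> R -> R) (r : R) : jet V :=
  jet_mul jet_norm (jet_mul jet_norm (jet_comp f r jet_slope)).

(** The spray coefficients G^0 = <p,y> u E and G^i = <p,y> H y^i - p^i u^2 W;
the second term of G^i has the shape of an energy. *)
Definition jet_spray (p : 'rV[R]_n) (E H W : R -> R -> R) (r : R)
    (A : 'I_n.+1) : jet V :=
  if unlift ord0 A is Some i then
    jet_sub (jet_mul (jet_edot p)
               (jet_mul (jet_comp H r jet_slope) (jet_coord (lift ord0 i))))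
            (jet_mul (jet_cst V (p 0 i)) (jet_energy W r))
  else jet_mul (jet_edot p) (jet_mul jet_norm (jet_comp E r jet_slope)).

Lemma is_jet_energy f r : derivable_upto 3 (f ^~ r) ->
  is_jet nonvertical (jet_energy f r).
Proof.
move=> f3; apply: is_jet_mul; first exact: is_jet_norm.
by apply: is_jet_mul; [exact: is_jet_norm|exact/is_jet_comp/is_jet_slope].
Qed.

Lemma is_jet_spray p E H W r A : derivable_upto 3 (E ^~ r) ->
  derivable_upto 3 (H ^~ r) -> derivable_upto 3 (W ^~ r) ->
  is_jet nonvertical (jet_spray p E H W r A).
Proof.
move=> E3 H3 W3; rewrite /jet_spray; case: unliftP => [i _|_].
  apply: is_jet_sub; apply: is_jet_mul.
  - exact: is_jet_edot.
  - by apply: is_jet_mul; [exact/is_jet_comp/is_jet_slope|exact: is_jet_coord].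
  - exact: is_jet_cst.
  - exact: is_jet_energy.
apply: is_jet_mul; first exact: is_jet_edot.
by apply: is_jet_mul; [exact: is_jet_norm|exact/is_jet_comp/is_jet_slope].
Qed.

End SprayJets.

(** * The spray of a spherically symmetric metric *)

Section SprayEquation.
Variables (R : realType) (n : nat).
Local Notation V := 'rV[R]_n.+1.
Local Notation dot v w := (edot (spat v) (spat w)).
Local Notation nrm y := (enorm (spat y)).
Implicit Types (x y v w : V) (f phi : R -> R -> R) (r : R).

(** Zv, the derivative of the slope along v multiplied by u. *)
Definition slope_dir y v : R := v 0 ord0 - slope y * dot y v / nrm y.

(** The second derivative of u^2 f(z, r) along v and w, arranged so that it is
visibly bilinear and symmetric in v and w. *)
Definition hessian f r y v w : R :=
  (2 * f (slope y) r - slope y * dz f (slope y) r) * dot v w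
  + dz (dz f) (slope y) r * slope_dir y v * slope_dir y w
  + dz f (slope y) r / nrm y
    * (dot y v * slope_dir y w + dot y w * slope_dir y v)
  + slope y * dz f (slope y) r / nrm y ^+ 2 * (dot y v * dot y w).

Lemma jet1_energy f r v y : spat y != 0 -> jet1 (jet_energy n f r) v y =
  2 * dot y v * f (slope y) r + nrm y * slope_dir y v * dz f (slope y) r.
Proof.
move=> y0; have u0 : nrm y != 0 by rewrite gt_eqF ?enorm_gt0.
by rewrite /= /slope_dir; move: (slope y) => z; field.
Qed.

Lemma jet2_energy f r v w y : spat y != 0 ->
  jet2 (jet_energy n f r) v w y = hessian f r y v w.
Proof.
move=> y0; have u0 : nrm y != 0 by rewrite gt_eqF ?enorm_gt0.
by rewrite /= /hessian /slope_dir; move: (slope y) => z; field.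
Qed.

Lemma slope_dir_linear y (a : R) v w :
  slope_dir y (a *: v + w) = a * slope_dir y v + slope_dir y w.
Proof. by rewrite /slope_dir edot_spat_linear !mxE; ring. Qed.

Lemma hessianC f r y v w : hessian f r y v w = hessian f r y w v.
Proof. by rewrite /hessian (edotC (spat v)); ring. Qed.

Lemma hessian_linear f r y v (a : R) w w' :
  hessian f r y v (a *: w + w') = a * hessian f r y v w + hessian f r y v w'.
Proof. by rewrite /hessian slope_dir_linear !edot_spat_linear; ring. Qed.

(** Only F^2 enters the spray. Isolating this consequence of the shape of F lets
the Hessian computation be applied both to phi and to the square of its square
root, before phi is known to be nonnegative. *)
Definition has_spherical_energy (rho : R) (F : V -> V -> R) phi : Prop :=
  forall x y, cylinder rho x -> spat x != 0 -> spat y != 0 ->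
    F x y ^+ 2 = nrm y ^+ 2 * phi (slope y) (nrm x).

Variables (rho : R) (F : V -> V -> R) (phi : R -> R -> R).
Hypothesis phiE : has_spherical_energy rho F phi.
Hypothesis phi_smooth : forall r k, 0 < r < rho -> derivable_upto k (phi ^~ r).

Lemma radius_bounds x : cylinder rho x -> spat x != 0 -> 0 < nrm x < rho.
Proof. by move=> xM x0; rewrite enorm_gt0. Qed.

Lemma energy_pder x y A B : cylinder rho x -> spat x != 0 -> spat y != 0 ->
  pder A (fun w => F x w ^+ 2) y
  = jet1 (jet_energy n phi (nrm x)) (delta_mx 0 A) y
  /\ pder B (pder A (fun w => F x w ^+ 2)) y
     = jet2 (jet_energy n phi (nrm x)) (delta_mx 0 A) (delta_mx 0 B) y.
Proof.
move=> xM x0 y0.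
have J : is_jet (@nonvertical R n) (jet_energy n phi (nrm x)).
  by apply/is_jet_energy/phi_smooth/radius_bounds.
have E w : nonvertical w -> F x w ^+ 2 = jet0 (jet_energy n phi (nrm x)) w.
  by move=> w0; rewrite phiE// expr2 -mulrA.
by have [] := is_jet_pder A B ord0 (@open_spat_neq0 R n) J E y0.
Qed.

Lemma fundamental_tensorE x y A B :
  cylinder rho x -> spat x != 0 -> spat y != 0 ->
  fundamental_tensor (F x) y A B =
    2^-1 * hessian phi (nrm x) y (delta_mx 0 A) (delta_mx 0 B).
Proof.
move=> xM x0 y0; rewrite mxE; have [_ ->] := energy_pder A B xM x0 y0.
by rewrite jet2_energy.
Qed.

Lemma fundamental_tensor_mul x y A w :
  cylinder rho x -> spat x != 0 -> spat y != 0 ->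
  (fundamental_tensor (F x) y *m w^T) A 0 =
    2^-1 * hessian phi (nrm x) y (delta_mx 0 A) w.
Proof.
move=> xM x0 y0; rewrite (linear_form_sum w (@hessian_linear _ _ _ _)).
rewrite mxE mulr_sumr; apply: eq_bigr => B _.
by rewrite fundamental_tensorE// [w^T _ _]mxE; ring.
Qed.

Lemma fundamental_tensor_quad x y v :
  cylinder rho x -> spat x != 0 -> spat y != 0 ->
  (v *m fundamental_tensor (F x) y *m v^T) 0 0 =
    2^-1 * hessian phi (nrm x) y v v.
Proof.
move=> xM x0 y0; rewrite -mulmxA.
rewrite (linear_form_sum v (@hessian_linear _ _ _ _)).
rewrite mxE mulr_sumr; apply: eq_bigr => A _.
by rewrite fundamental_tensor_mul// (hessianC _ _ _ v); ring.
Qed.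

(** A positive definite matrix has no nonzero vector in its kernel. *)
Lemma fundamental_tensor_unit x y : minkowski_norm (F x) -> spat y != 0 ->
  fundamental_tensor (F x) y \in unitmx.
Proof.
move=> [_ _ _ pos] y0; rewrite unitmxE unitfE; apply/det0P => -[v v0 vg].
have yn0 : y != 0.
  by apply: contraNneq y0 => ->; apply/eqP/rowP => i; rewrite !mxE.
by have := pos y v yn0 v0; rewrite vg mul0mx mxE ltxx.
Qed.

Hypothesis phi_dr : forall z r, 0 < r < rho -> derivable (phi z) r 1.
Hypothesis phi_z_dr : forall z r, 0 < r < rho -> derivable (dz phi z) r 1.

Lemma dX_energy x y B : cylinder rho x -> spat x != 0 -> spat y != 0 ->
  dX B (fun x y => F x y ^+ 2) x y =
  nrm y ^+ 2 * (dr phi (slope y) (nrm x)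
                * (dot x (delta_mx 0 B) / nrm x)).
Proof.
move=> xM x0 y0; rewrite /dX /pder.
set v := delta_mx 0 B.
have D1 : is_derive (nrm x) 1 (phi (slope y)) (dr phi (slope y) (nrm x)).
  by rewrite /dr derive1E; apply/derivableP/phi_dr/radius_bounds.
have D := is_derive_comp (f := fun x => nrm x) D1 (is_derive_enorm_spat v x0).
have {}D : is_derive x v (fun x' => nrm y ^+ 2 * phi (slope y) (nrm x'))
    (nrm y ^+ 2 * (dr phi (slope y) (nrm x) * (dot x v / nrm x))).
  by eapply is_derive_eq; first (derive_rules; exact: D); rewrite mul0r add0r.
apply: (@derive_val _ _ _ _ _ _ _ (near_eq_is_derive _ D)).
near=> x'; rewrite phiE//; near: x'.
- by apply: open_nbhs_nbhs; split=> //; exact: open_cylinder.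
- by apply: open_nbhs_nbhs; split=> //; exact: open_spat_neq0.
Unshelve. all: by end_near. Qed.

(** The inner derivative is an explicit function of |x| near x, so only the
radius is differentiated: phi and phi_z become phi_r and (phi_z)_r. *)
Lemma dX_dY_energy x y A B : cylinder rho x -> spat x != 0 -> spat y != 0 ->
  dX B (dY A (fun x y => F x y ^+ 2)) x y =
  (2 * dot y (delta_mx 0 A) * dr phi (slope y) (nrm x)
   + nrm y * slope_dir y (delta_mx 0 A) * dr (dz phi) (slope y) (nrm x))
  * (dot x (delta_mx 0 B) / nrm x).
Proof.
move=> xM x0 y0; rewrite /dX /dY {1}/pder.
set v := delta_mx 0 A; set w := delta_mx 0 B.
have rP := radius_bounds xM x0.
have D1 : is_derive (nrm x) 1 (phi (slope y)) (dr phi (slope y) (nrm x)).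
  by rewrite /dr derive1E; apply/derivableP/phi_dr.
have D2 : is_derive (nrm x) 1 (dz phi (slope y))
    (dr (dz phi) (slope y) (nrm x)).
  by rewrite /dr derive1E; apply/derivableP/phi_z_dr.
have Dx := is_derive_enorm_spat w x0.
have {}D1 := is_derive_comp (f := fun x => nrm x) D1 Dx.
have {}D2 := is_derive_comp (f := fun x => nrm x) D2 Dx.
have D : is_derive x w (fun x' => 2 * dot y v * phi (slope y) (nrm x')
      + nrm y * slope_dir y v * dz phi (slope y) (nrm x'))
    ((2 * dot y v * dr phi (slope y) (nrm x)
      + nrm y * slope_dir y v * dr (dz phi) (slope y) (nrm x))
     * (dot x w / nrm x)).
  eapply is_derive_eq; first by derive_rules.
  by ring.
apply: (@derive_val _ _ _ _ _ _ _ (near_eq_is_derive _ D)).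
near=> x'.
have [||->] // := @energy_pder x' y A A _ _ y0; last by rewrite jet1_energy.
- by near: x'; apply: open_nbhs_nbhs; split=> //; exact: open_cylinder.
- by near: x'; apply: open_nbhs_nbhs; split=> //; exact: open_spat_neq0.
Unshelve. all: by end_near. Qed.

(** The candidate coefficients solve the linear system that defines the spray,
and g is invertible. The system reduces to the two relations
phi_z U + 2 phi V = phi_r / (2r) and phi_zz U + phi_z V = phi_zr / (2r), which
are what U and V solve by Cramer's rule, and to the definition of W. *)
Lemma sprayE x y C : minkowski_norm (F x) ->
  cylinder rho x -> spat x != 0 -> spat y != 0 ->
  let z := slope y in let r := nrm x in
  2 * phi z r - z * dz phi z r != 0 ->
  2 * phi z r * dz (dz phi) z r - dz phi z r ^+ 2 != 0 ->
  spray F C x y =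
    jet0 (jet_spray (spat x) (funE phi) (funH phi) (funW phi) r C) y.
Proof.
move=> mF xM x0 y0 z r K0 D0.
have r0 : r != 0 by rewrite gt_eqF ?enorm_gt0.
have u0 : nrm y != 0 by rewrite gt_eqF ?enorm_gt0.
pose G : V := \row_A
  jet0 (jet_spray (spat x) (funE phi) (funH phi) (funW phi) r A) y.
have G0 : G 0 ord0 = dot x y * (nrm y * funE phi z r).
  by rewrite mxE /jet_spray unlift_none.
have dotG v : dot v G = dot x y * funH phi z r * dot v y
                        - nrm y ^+ 2 * funW phi z r * dot v x.
  have -> : spat G = (dot x y * funH phi z r) *: spat y
      + ((- (nrm y ^+ 2 * funW phi z r)) *: spat x + 0).
    apply/rowP => i; rewrite mxE mxE /jet_spray liftK /= !mxE -/z.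
    by ring.
  rewrite !edot_linear.
  suff -> : edot (spat v) 0 = 0 by ring.
  by rewrite /edot big1// => i _; rewrite [X in _ * X]mxE mulr0.
have -> : jet0 (jet_spray (spat x) (funE phi) (funH phi) (funW phi) r C) y
    = G^T C 0 by rewrite !mxE.
have gU := fundamental_tensor_unit mF y0.
(* G = g^-1 (g G): only g G, a value of the Hessian, has to be computed. *)
rewrite -(mulKmx gU G^T) mxE /spray mulr_sumr; apply: eq_bigr => A _.
rewrite fundamental_tensor_mul// mulrCA; congr (_ * _).
rewrite dX_energy//; under eq_bigr do rewrite dX_dY_energy// -mulrA.
set c := (_ + _ * dr (dz phi) _ _).
rewrite -mulr_sumr (_ : \sum_(_ < _) _ = dot x y / r); last first.
  rewrite (linear_form_sum y (@edot_spat_linear _ _ (spat x))) mulr_suml.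
  by apply: eq_bigr => B _; rewrite -/r; ring.
rewrite /c {c} /hessian /slope_dir dotG dotG G0 -sqr_enorm.
rewrite (edotC (spat y) (spat x))
  (edotC (spat (delta_mx 0 A)) (spat y)) (edotC (spat (delta_mx 0 A)) (spat x)).
rewrite -/z -/r /funE /funH /funW /funU /funV.
by field; rewrite K0 D0 u0 r0.
Qed.

End SprayEquation.

(** * Nondegeneracy *)

Section Frames.
Variables (R : realType) (n : nat) (i : 'I_n).
Implicit Types (a b : R).

(** The plane of the time axis and of the i-th spatial axis. The points
[frame 0 r] and the tangent vectors [frame z 1] realize every radius r > 0 and
every slope z, with u = 1. *)
Definition frame a b : 'rV[R]_n.+1 :=
  a *: delta_mx 0 ord0 + b *: delta_mx 0 (lift ord0 i).

Lemma frame_time a b : frame a b 0 ord0 = a.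
Proof. by rewrite /frame !mxE !eqxx mulr1 mulr0 addr0. Qed.

Lemma edot_frame p a b : edot p (spat (frame a b)) = b * p 0 i.
Proof.
rewrite /frame -[b *: _]addr0 !edot_spat_linear edot_spat_time edot_spat_space.
rewrite mulr0 add0r [X in _ + X]/edot big1 ?addr0// => j _.
by rewrite !mxE mulr0.
Qed.

Lemma spat_frame a b j : spat (frame a b) 0 j = b * kron i j.
Proof. by rewrite /frame !mxE mulr0 add0r (inj_eq lift_inj) /kron eq_sym. Qed.

Lemma edot_frames a b a' b' :
  edot (spat (frame a b)) (spat (frame a' b')) = b * b'.
Proof. by rewrite edot_frame spat_frame /kron eqxx mulr1 mulrC. Qed.

Lemma enorm_frame a b : 0 <= b -> enorm (spat (frame a b)) = b.
Proof. by move=> b0; rewrite /enorm edot_frames -expr2 sqrtr_sqr ger0_norm. Qed.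

Lemma spat_frame_neq0 a b : 0 < b -> spat (frame a b) != 0.
Proof. by move=> b0; apply: enorm_gt0P; rewrite enorm_frame// ltW. Qed.

Lemma slope_frame a : slope (frame a 1) = a.
Proof. by rewrite /slope frame_time enorm_frame// divr1. Qed.

Lemma slope_dir_frame z a b : slope_dir (frame z 1) (frame a b) = a - z * b.
Proof.
by rewrite /slope_dir frame_time slope_frame edot_frames enorm_frame//; field.
Qed.

End Frames.

Section Nondegeneracy.
Variables (R : realType) (n : nat) (rho : R).
Variables (F : 'rV[R]_n.+1 -> 'rV[R]_n.+1 -> R) (phi : R -> R -> R).
Hypothesis phiE : has_spherical_energy rho F phi.
Hypothesis phi_smooth : forall r k, 0 < r < rho -> derivable_upto k (phi ^~ r).
Hypothesis F_convex : forall x, cylinder rho x -> minkowski_norm (F x).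
Hypothesis n_ge2 : (2 <= n)%N.

(** On the plane of the time axis and of e_1, and in terms of b = <y,v> and Zv,
the Hessian at (z, e_1) is the binary form
2 phi b^2 + 2 phi_z b Zv + phi_zz Zv^2, whose positivity gives the last two
inequalities; the first one comes from a spatial direction orthogonal to e_1. *)
Lemma spherical_nondegenerate z r : 0 < r < rho ->
  [/\ 0 < 2 * phi z r - z * dz phi z r,
      0 < dz (dz phi) z r
    & 0 < 2 * phi z r * dz (dz phi) z r - dz phi z r ^+ 2].
Proof.
move=> /andP[r0 rrho].
pose i : 'I_n := Ordinal (ltnW n_ge2); pose j : 'I_n := Ordinal n_ge2.
pose x := frame i 0 r; pose y := frame i z 1.
have xr : enorm (spat x) = r by rewrite enorm_frame// ltW.
have xM : cylinder rho x by rewrite /cylinder /mkset xr.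
have x0 : spat x != 0 by exact: spat_frame_neq0.
have y0 : spat y != 0 by apply: spat_frame_neq0.
have pos v : v != 0 -> 0 < hessian phi r y v v.
  move=> v0; have yn0 : y != 0.
    by apply: contraNneq y0 => ->; apply/eqP/rowP => k; rewrite !mxE.
  have [_ _ _ /(_ y v yn0 v0)] := F_convex xM.
  rewrite (fundamental_tensor_quad phiE phi_smooth)// xr.
  by rewrite pmulr_rgt0 ?invr_gt0.
have hE v : hessian phi r y v v =
    (2 * phi z r - z * dz phi z r) * edot (spat v) (spat v)
    + dz (dz phi) z r * slope_dir y v ^+ 2
    + 2 * dz phi z r * edot (spat y) (spat v) * slope_dir y v
    + z * dz phi z r * edot (spat y) (spat v) ^+ 2.
  by rewrite /hessian slope_frame enorm_frame//; field.
have frame_neq0 k a b : (a != 0) || (b != 0) -> frame k a b != 0 :> 'rV[R]_n.+1.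
  apply: contraTneq => /rowP E; rewrite negb_or !negbK.
  have := E (lift ord0 k); have := E ord0.
  rewrite frame_time mxE => ->; rewrite eqxx /= !mxE mulr0 add0r !eqxx mulr1.
  by move=> ->.
have K : 0 < 2 * phi z r - z * dz phi z r.
  have := pos _ (frame_neq0 j 0 1 _); rewrite oner_neq0 orbT => /(_ isT).
  rewrite hE /slope_dir frame_time edot_frames edot_frame spat_frame /kron.
  by rewrite !(mulr1, mulr0, mul0r, subr0, expr0n, addr0).
have P : 0 < dz (dz phi) z r.
  have := pos _ (frame_neq0 i 1 0 _); rewrite oner_neq0 => /(_ isT).
  rewrite hE slope_dir_frame !edot_frames.
  by rewrite !(mulr1, mulr0, mul0r, subr0, expr0n, addr0, add0r, expr1n).
split=> //.
(* b = phi_zz and Zv = - phi_z complete the square: the form takes the value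
   phi_zz (2 phi phi_zz - phi_z^2) there. *)
set p := phi z r; set p1 := dz phi z r; set p2 := dz (dz phi) z r.
have := pos _ (frame_neq0 i (z * p2 - p1) p2 _).
rewrite (gt_eqF P) orbT => /(_ isT); rewrite hE slope_dir_frame !edot_frames.
rewrite -/p -/p1 -/p2 (_ : _ + _ = p2 * (2 * p * p2 - p1 ^+ 2)); last by ring.
by rewrite pmulr_rgt0.
Qed.

End Nondegeneracy.

Section SmoothSlices.
Variable R : realType.
Implicit Types (f g : R -> R) (t : R).

Lemma is_derive_derive1 f t : derivable f t 1 -> is_derive t 1 f (derive1 f t).
Proof. by move=> df; rewrite derive1E; exact: derivableP. Qed.

Lemma derivable_uptoS k f f' : (forall t : R, is_derive t 1 f (f' t)) ->
  derivable_upto k f' -> derivable_upto k.+1 f.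
Proof.
move=> ff' kf'; split=> [t|]; first by case: (ff' t).
rewrite (_ : derive1 f = f')//; apply/funext => t.
by rewrite derive1E; apply: derive_val.
Qed.

Lemma derivable_uptoW k f : derivable_upto k.+1 f -> derivable_upto k f.
Proof. by elim: k f => [//|k IH] f [f1 f2]; split=> //; exact: IH. Qed.

Lemma derivable_upto_cst k (c : R) : derivable_upto k (fun=> c).
Proof.
by elim: k c => [//|k IH] c; apply: (derivable_uptoS _ (IH 0)).
Qed.

Lemma derivable_upto_id k : derivable_upto k (fun t : R => t).
Proof.
by case: k => [//|k]; apply: (derivable_uptoS _ (derivable_upto_cst k 1)).
Qed.

Lemma derivable_upto_add k f g : derivable_upto k f -> derivable_upto k g ->
  derivable_upto k (fun t => f t + g t).
Proof.
elim: k f g => [//|k IH] f g [f1 kf] [g1 kg].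
have D t := is_derive_add (is_derive_derive1 (f1 t)) (is_derive_derive1 (g1 t)).
exact: (derivable_uptoS D (IH _ _ kf kg)).
Qed.

Lemma derivable_upto_mul k f g : derivable_upto k f -> derivable_upto k g ->
  derivable_upto k (fun t => f t * g t).
Proof.
elim: k f g => [//|k IH] f g kf kg; have [f1 kf'] := kf; have [g1 kg'] := kg.
have D t := is_derive_mul (is_derive_derive1 (f1 t)) (is_derive_derive1 (g1 t)).
apply: (derivable_uptoS D).
by apply: derivable_upto_add; apply: IH => //; exact: derivable_uptoW.
Qed.

Lemma derivable_upto_opp k f : derivable_upto k f ->
  derivable_upto k (fun t => - f t).
Proof.
move=> kf; rewrite (_ : (fun t => - f t) = fun t => -1 * f t).
  by apply: derivable_upto_mul; [exact: derivable_upto_cst|].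
by apply/funext => t; rewrite mulN1r.
Qed.

Lemma derivable_upto_exp k f m : derivable_upto k f ->
  derivable_upto k (fun t => f t ^+ m).
Proof.
move=> kf; elim: m => [|m IH]; first exact: derivable_upto_cst.
by under eq_fun do rewrite exprS; exact: derivable_upto_mul.
Qed.

Lemma derivable_upto_inv k f : (forall t, f t != 0) -> derivable_upto k f ->
  derivable_upto k (fun t => (f t)^-1).
Proof.
move=> f0; elim: k => [//|k IH] kf; have [f1 kf'] := kf.
have kV := IH (derivable_uptoW kf).
have D t := is_derive_inv (f0 t) (is_derive_derive1 (f1 t)).
apply: (derivable_uptoS D); apply: derivable_upto_opp.
apply: derivable_upto_mul => //; under eq_fun do rewrite -exprVn.
exact: derivable_upto_exp.
Qed.

End SmoothSlices.

(** Regularity of phi is read off along the curves z |-> (r e_1, (z, e_1)) and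
r |-> (r e_1, (z, e_1)) of the tangent bundle: along them, derivatives in z and
r are directional derivatives of F, to which smoothness of F applies again. *)
Section SphericalRegularity.
Variables (R : realType) (n : nat) (rho : R) (i : 'I_n).
Local Notation V := 'rV[R]_n.+1.
Implicit Types z r : R.
Variable F : V -> V -> R.
Let TM := [set p : V * V | @cylinder R n rho p.1 /\ p.2 != 0]%classic.
Hypothesis F_smooth : smooth_on TM (fun p => F p.1 p.2).

Let pt (z r : R) : V * V := (frame i 0 r, frame i z 1).
Let dirz : V * V := (0, delta_mx 0 ord0).
Let dirr : V * V := (delta_mx 0 (lift ord0 i), 0).

Lemma pt_TM z r : 0 < r < rho -> TM (pt z r).
Proof.
move=> /andP[r0 rrho]; split=> /=.
  by rewrite /cylinder /mkset enorm_frame ?ltW.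
have := spat_frame_neq0 i z (@ltr01 R).
by apply: contraNneq => ->; apply/eqP/rowP => k; rewrite !mxE.
Qed.

Lemma smooth_derive (G : V * V -> R) v :
  smooth_on TM G -> smooth_on TM ('D_v G).
Proof. by move=> sG k; have [_ dG] := sG k.+1; exact: dG. Qed.

Lemma is_derive_slice_z (G : V * V -> R) z r : smooth_on TM G -> 0 < r < rho ->
  is_derive z 1 (fun z => G (pt z r)) ('D_dirz G (pt z r)).
Proof.
move=> sG rP; have [dG _] := sG 1%N.
have hc h : pt (h + z) r = h *: dirz + pt z r.
  rewrite /pt /dirz /frame; congr (_, _) => /=.
    by rewrite scaler0 add0r.
  by rewrite scalerDl addrA.
apply/(is_derive_alongP (c := pt ^~ r) G _ hc).
exact/derivableP/diff_derivable/dG/pt_TM.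
Qed.

Lemma is_derive_slice_r (G : V * V -> R) z r : smooth_on TM G -> 0 < r < rho ->
  is_derive r 1 (fun r => G (pt z r)) ('D_dirr G (pt z r)).
Proof.
move=> sG rP; have [dG _] := sG 1%N.
have hc h : pt z (h + r) = h *: dirr + pt z r.
  rewrite /pt /dirr /frame; congr (_, _) => /=.
    by rewrite scalerDl !scale0r !add0r.
  by rewrite scaler0 add0r.
apply/(is_derive_alongP G _ hc).
exact/derivableP/diff_derivable/dG/pt_TM.
Qed.

Lemma derivable_upto_slice (G : V * V -> R) r k :
  smooth_on TM G -> 0 < r < rho -> derivable_upto k (fun z => G (pt z r)).
Proof.
move=> sG rP; elim: k G sG => [//|k IH] G sG.
have D z := is_derive_slice_z z sG rP.
exact: (derivable_uptoS D (IH _ (smooth_derive dirz sG))).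
Qed.

Variable phi : R -> R -> R.
Hypothesis phiE : forall z r, 0 < r < rho ->
  phi z r = F (frame i 0 r) (frame i z 1) ^+ 2.

Let G (p : V * V) := F p.1 p.2.
Let Gz := 'D_dirz G.
Let Gr := 'D_dirr G.
Let Gzr := 'D_dirr Gz.

Lemma near_radius r : 0 < r < rho -> \near r, 0 < r < rho.
Proof.
move=> /andP[r0 rrho]; near=> t; apply/andP; split; near: t.
  by apply: open_nbhs_nbhs; split=> //; exact: open_gt.
by apply: open_nbhs_nbhs; split=> //; exact: open_lt.
Unshelve. all: by end_near. Qed.

Lemma is_derive_phi_r z r : 0 < r < rho ->
  is_derive r 1 (phi z) (2 * G (pt z r) * Gr (pt z r)).
Proof.
move=> rP; have D := is_derive_slice_r z F_smooth rP.
apply: (@near_eq_is_derive _ _ _ (fun r => G (pt z r) ^+ 2)).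
  by near=> t; rewrite phiE//; near: t; exact: near_radius.
by eapply is_derive_eq; first (derive_rules; exact: D); rewrite /= expr1.
Unshelve. all: by end_near. Qed.

Lemma dz_phi z r : 0 < r < rho ->
  dz phi z r = 2 * G (pt z r) * Gz (pt z r).
Proof.
move=> rP; have D := is_derive_slice_z z F_smooth rP.
rewrite /dz derive1E (_ : phi ^~ r = fun z => G (pt z r) ^+ 2).
  apply: derive_val.
  by eapply is_derive_eq; first (derive_rules; exact: D); rewrite /= expr1.
by apply/funext => t; rewrite phiE.
Qed.

Lemma is_derive_dz_phi_r z r : 0 < r < rho ->
  is_derive r 1 (dz phi z)
    (2 * (Gr (pt z r) * Gz (pt z r) + G (pt z r) * Gzr (pt z r))).
Proof.
move=> rP; have D1 := is_derive_slice_r z F_smooth rP.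
have D2 := is_derive_slice_r z (smooth_derive dirz F_smooth) rP.
apply: (@near_eq_is_derive _ _ _ (fun r => 2 * G (pt z r) * Gz (pt z r))).
  by near=> t; rewrite dz_phi//; near: t; exact: near_radius.
eapply is_derive_eq; first by derive_rules.
by rewrite mul0r add0r -!mulrA -mulrDr.
Unshelve. all: by end_near. Qed.

Lemma derivable_upto_phi r k : 0 < r < rho -> derivable_upto k (phi ^~ r).
Proof.
move=> rP; rewrite (_ : phi ^~ r = fun z => G (pt z r) ^+ 2).
  by apply/derivable_upto_exp/derivable_upto_slice.
by apply/funext => t; rewrite phiE.
Qed.

Lemma derivable_upto_dr_phi r k : 0 < r < rho -> derivable_upto k (dr phi ^~ r).
Proof.
move=> rP.
rewrite (_ : dr phi ^~ r = fun z => 2 * G (pt z r) * Gr (pt z r)).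
  apply: derivable_upto_mul; first apply: derivable_upto_mul.
  - exact: derivable_upto_cst.
  - exact: derivable_upto_slice.
  - exact/derivable_upto_slice/rP/smooth_derive.
apply/funext => z; rewrite /dr derive1E; apply: derive_val.
exact: is_derive_phi_r.
Qed.

Lemma derivable_upto_dr_dz_phi r k : 0 < r < rho ->
  derivable_upto k (dr (dz phi) ^~ r).
Proof.
move=> rP.
rewrite (_ : dr (dz phi) ^~ r = fun z =>
    2 * (Gr (pt z r) * Gz (pt z r) + G (pt z r) * Gzr (pt z r))).
  apply: derivable_upto_mul; first exact: derivable_upto_cst.
  have sGz := smooth_derive dirz F_smooth.
  have sGr := smooth_derive dirr F_smooth.
  have sGzr := smooth_derive dirr sGz.
  have slice H sH := @derivable_upto_slice H r k sH rP.
  exact: (derivable_upto_add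
    (derivable_upto_mul (slice _ sGr) (slice _ sGz))
    (derivable_upto_mul (slice _ F_smooth) (slice _ sGzr))).
apply/funext => z; rewrite /dr derive1E; apply: derive_val.
exact: is_derive_dz_phi_r.
Qed.

Hypothesis phi_nondeg : forall z r, 0 < r < rho ->
  2 * phi z r - z * dz phi z r != 0 /\
  2 * phi z r * dz (dz phi) z r - dz phi z r ^+ 2 != 0.

Lemma derivable_upto_funUVW r k : 0 < r < rho ->
  [/\ derivable_upto k (funU phi ^~ r), derivable_upto k (funV phi ^~ r)
    & derivable_upto k (funW phi ^~ r)].
Proof.
move=> rP; have r0 : r != 0 by case/andP: rP => r0 _; rewrite gt_eqF.
have kphi := derivable_upto_phi k rP.
have kdz : derivable_upto k (dz phi ^~ r) := (derivable_upto_phi k.+1 rP).2.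
have kdzz : derivable_upto k (dz (dz phi) ^~ r) :=
  (derivable_upto_phi k.+2 rP).2.2.
have kdr := derivable_upto_dr_phi k rP.
have kdzr := derivable_upto_dr_dz_phi k rP.
have c2 := derivable_upto_cst k (2 : R).
have c2r := derivable_upto_cst k (2 * r).
have kid := @derivable_upto_id R k.
have mul f g := @derivable_upto_mul R k f g.
have sub f g kf kg :=
  @derivable_upto_add R k f _ kf (@derivable_upto_opp R k g kg).
have c2phi := mul _ _ c2 kphi.
have kD := mul _ _ c2r
  (sub _ _ (mul _ _ c2phi kdzz) (derivable_upto_exp 2 kdz)).
have kK := mul _ _ c2r (sub _ _ c2phi (mul _ _ kid kdz)).
have kU := sub _ _ (mul _ _ c2phi kdzr) (mul _ _ kdz kdr).
have kV := sub _ _ (mul _ _ kdr kdzz) (mul _ _ kdz kdzr).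
have D0 z : 2 * r * (2 * phi z r * dz (dz phi) z r - dz phi z r ^+ 2) != 0.
  by rewrite !mulf_neq0//; have [] := phi_nondeg z rP.
have K0 z : 2 * r * (2 * phi z r - z * dz phi z r) != 0.
  by rewrite !mulf_neq0//; have [] := phi_nondeg z rP.
split.
- exact: (mul _ _ kU (derivable_upto_inv D0 kD)).
- exact: (mul _ _ kV (derivable_upto_inv D0 kD)).
- exact: (mul _ _ kdr (derivable_upto_inv K0 kK)).
Qed.

Lemma derivable_upto_funEHW r k : 0 < r < rho ->
  [/\ derivable_upto k (funE phi ^~ r), derivable_upto k (funH phi ^~ r)
    & derivable_upto k (funW phi ^~ r)].
Proof.
move=> rP; have [kU kV kW] := derivable_upto_funUVW k rP; split=> //.
  exact: (derivable_upto_add kU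
    (derivable_upto_mul (derivable_upto_id R k) kV)).
exact: (derivable_upto_add kV kW).
Qed.

End SphericalRegularity.

(** * The Berwald curvature *)

(** The formula for the spray holds on the whole open set of nonvertical y, so
its derivatives in y are those of the jet. The sign of phi is settled first, by
applying the nondegeneracy result to psi = (sqrt phi)^2, which satisfies
F^2 = u^2 psi whatever the sign of phi; psi > 0 then forces phi = psi. *)
Lemma berwald_spherical (R : realType) (n : nat) (rho : R) (phi : R -> R -> R)
    (F : 'rV[R]_n.+1 -> 'rV[R]_n.+1 -> R) (x y : 'rV[R]_n.+1) :
  (2 <= n)%N -> finsler_metric (@cylinder R n rho) F ->
  (forall x y : 'rV[R]_n.+1, @cylinder R n rho x -> spat y != 0 ->
     F x y = enorm (spat y) * Num.sqrt (phi (slope y) (enorm (spat x)))) ->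
  @cylinder R n rho x -> spat x != 0 -> spat y != 0 ->
  let r := enorm (spat x) in
  forall A B C D : 'I_n.+1, berwald F A B C D x y =
    jet3 (jet_spray (spat x) (funE phi) (funH phi) (funW phi) r A)
      (delta_mx 0 B) (delta_mx 0 C) (delta_mx 0 D) y.
Proof.
move=> n2 [F_smooth F_mink] Fphi xM x0 y0 r A B C D.
pose i : 'I_n := Ordinal (ltnW n2).
have rP : 0 < r < rho by exact: radius_bounds.
have F_frame z t : 0 < t < rho ->
    F (frame i 0 t) (frame i z 1) = Num.sqrt (phi z t).
  move=> /andP[t0 trho]; rewrite Fphi ?spat_frame_neq0//.
    by rewrite slope_frame !enorm_frame ?mul1r// ltW.
  by rewrite /cylinder /mkset enorm_frame// ltW.
have phi_gt0 z t : 0 < t < rho -> 0 < phi z t.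
  move=> tP; rewrite -sqrtr_gt0.
  pose psi z t := Num.sqrt (phi z t) ^+ 2.
  have psiE : has_spherical_energy rho F psi.
    by move=> x' y' x'M _ y'0; rewrite Fphi// exprMn.
  have psi_frame a b : 0 < b < rho ->
      psi a b = F (frame i 0 b) (frame i a 1) ^+ 2.
    by move=> bP; rewrite F_frame.
  have [_ p2 D0] := spherical_nondegenerate psiE
    (fun b k bP => derivable_upto_phi F_smooth psi_frame k bP) F_mink n2 z tP.
  have : 0 < psi z t.
    have : 0 < 2 * psi z t * dz (dz psi) z t.
      by apply: lt_le_trans D0 _; rewrite gerBl sqr_ge0.
    by rewrite pmulr_lgt0// pmulr_rgt0.
  by rewrite /psi lt0r sqrf_eq0 => /andP[q _]; rewrite lt0r q sqrtr_ge0.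
have phiE : has_spherical_energy rho F phi.
  move=> x' y' x'M x'0 y'0.
  have phi0 := phi_gt0 (slope y') _ (radius_bounds x'M x'0).
  by rewrite Fphi// exprMn (sqr_sqrtr (ltW phi0)).
have phi_frame z t : 0 < t < rho ->
    phi z t = F (frame i 0 t) (frame i z 1) ^+ 2.
  by move=> tP; rewrite F_frame// sqr_sqrtr// ltW// phi_gt0.
have phi_smooth t k (tP : 0 < t < rho) : derivable_upto k (phi ^~ t).
  exact: (derivable_upto_phi F_smooth phi_frame).
have nondeg z t : 0 < t < rho -> 2 * phi z t - z * dz phi z t != 0 /\
    2 * phi z t * dz (dz phi) z t - dz phi z t ^+ 2 != 0.
  move=> tP.
  have [K0 _ D0] := spherical_nondegenerate phiE phi_smooth F_mink n2 z tP.
  by rewrite !gt_eqF.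
have phi_dr z t : 0 < t < rho -> derivable (phi z) t 1.
  by move=> tP; have [] := is_derive_phi_r F_smooth phi_frame z tP.
have phi_z_dr z t : 0 < t < rho -> derivable (dz phi z) t 1.
  by move=> tP; have [] := is_derive_dz_phi_r F_smooth phi_frame z tP.
have [E3 H3 W3] := derivable_upto_funEHW F_smooth phi_frame nondeg 3 rP.
have S w : nonvertical w -> spray F A x w =
    jet0 (jet_spray (spat x) (funE phi) (funH phi) (funW phi) r A) w.
  move=> w0; have [K0 D0] := nondeg (slope w) r rP.
  by apply: (sprayE phiE) => //; exact: F_mink.
have J := is_jet_spray (spat x) (E := funE phi) (H := funH phi)
  (W := funW phi) A E3 H3 W3.
by have [_ _] := is_jet_pder B C D (@open_spat_neq0 R n) J S y0.
Qed.

Section CoordinateDirections.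
Variables (R : realType) (n : nat).

Lemma kronC (i j : 'I_n) : kron i j = kron j i :> R.
Proof. by rewrite /kron eq_sym. Qed.

Lemma delta_time : (delta_mx 0 ord0 : 'rV[R]_n.+1) 0 ord0 = 1.
Proof. by rewrite mxE !eqxx. Qed.

Lemma delta_time_space i : (delta_mx 0 ord0 : 'rV[R]_n.+1) 0 (lift ord0 i) = 0.
Proof. by rewrite mxE. Qed.

Lemma delta_space_time i : (delta_mx 0 (lift ord0 i) : 'rV[R]_n.+1) 0 ord0 = 0.
Proof. by rewrite mxE. Qed.

Lemma delta_space i j :
  (delta_mx 0 (lift ord0 j) : 'rV[R]_n.+1) 0 (lift ord0 i) = kron i j.
Proof. by rewrite mxE eqxx (inj_eq lift_inj). Qed.

Lemma spat_delta_time j : spat (delta_mx 0 ord0 : 'rV[R]_n.+1) 0 j = 0.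
Proof. by rewrite mxE delta_time_space. Qed.

Lemma spat_delta_space i j :
  spat (delta_mx 0 (lift ord0 i) : 'rV[R]_n.+1) 0 j = kron i j.
Proof. by rewrite mxE delta_space kronC. Qed.

Definition directionE := (delta_time, delta_time_space, delta_space_time,
  delta_space, @edot_spat_time R n, @edot_spat_space R n, spat_delta_time,
  spat_delta_space).

End CoordinateDirections.

Theorem theorem3 (R : realType) (n : nat) (rho : R) (phi : R -> R -> R)
  (F : 'rV[R]_n.+1 -> 'rV[R]_n.+1 -> R)
  (hn : (2 <= n)%N) (hrho : 0 < rho)
  (hphi : forall z r : R, 0 < r -> r < rho ->
     differentiable (fun p : R * R => phi p.1 p.2) (z, r))
  (hF : finsler_metric (@cylinder R n rho) F)
  (hFphi : forall x y : 'rV[R]_n.+1, @cylinder R n rho x -> spat y != 0 ->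
     F x y = enorm (spat y) *
       Num.sqrt (phi (y 0 ord0 / enorm (spat y)) (enorm (spat x))))
  (x y : 'rV[R]_n.+1) (hxM : @cylinder R n rho x)
  (hx : spat x != 0) (hy : spat y != 0) :
  let xs := fun i : 'I_n => spat x 0 i in
  let ys := fun i : 'I_n => spat y 0 i in
  let d := fun i j : 'I_n => kron i j : R in
  let u := enorm (spat y) in
  let z := y 0 ord0 / u in
  let r := enorm (spat x) in
  let s := edot (spat x) (spat y) / u in
  let E := funE phi z r in
  let Ez := dz (funE phi) z r in
  let Ezz := dz (dz (funE phi)) z r in
  let Ezzz := dz (dz (dz (funE phi))) z r in
  let Hz := dz (funH phi) z r in
  let Hzz := dz (dz (funH phi)) z r in
  let Hzzz := dz (dz (dz (funH phi))) z r in
  let Wz := dz (funW phi) z r in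
  let Wzz := dz (dz (funW phi)) z r in
  let Wzzz := dz (dz (dz (funW phi))) z r in
  let B := fun a b c e : 'I_n.+1 => berwald F a b c e x y in
  let o : 'I_n.+1 := ord0 in
  let t := fun i : 'I_n => lift ord0 i : 'I_n.+1 in
  B o o o o = s / u * Ezzz
  /\
  (forall l : 'I_n, B o o o (t l) =
     1 / u * Ezz * xs l - s / u ^+ 2 * (Ezz + z * Ezzz) * ys l)
  /\
  (forall k l : 'I_n, B o o (t k) (t l) =
     s * z * (z * Ezzz + 3 * Ezz) * (ys k * ys l / u ^+ 3)
     - z * Ezz * ((xs k * ys l + xs l * ys k) / u ^+ 2)
     - s * z * Ezz * (d k l / u))
  /\
  (forall j k l : 'I_n, B o (t j) (t k) (t l) =
     s / u ^+ 4 * (E - z * Ez - 2 * z ^+ 2 * Ezz - 1 / 3 * z ^+ 3 * Ezzz)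
       * cyc (fun j k l => ys j * ys k * ys l) j k l
     + 1 / u ^+ 3 * (- E + z * Ez + z ^+ 2 * Ezz)
       * cyc (fun j k l => ys j * ys k * xs l) j k l
     + 1 / u * (E - z * Ez) * cyc (fun j k l => d j k * xs l) j k l
     + s / u ^+ 2 * (- E + z * Ez + z ^+ 2 * Ezz)
       * cyc (fun j k l => d j k * ys l) j k l)
  /\
  (forall i : 'I_n, B (t i) o o o =
     s / u ^+ 2 * Hzzz * ys i - 1 / u * Wzzz * xs i)
  /\
  (forall i l : 'I_n, B (t i) o o (t l) =
     - (s / u ^+ 3) * (2 * Hzz + z * Hzzz) * ys i * ys l
     + 1 / u ^+ 2 * Hzz * ys i * xs l
     + z / u ^+ 2 * Wzzz * ys l * xs i
     + s / u * Hzz * d i l)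
  /\
  (forall i k l : 'I_n, B (t i) o (t k) (t l) =
     s / u ^+ 4 * (3 * Hz + 5 * z * Hzz + z ^+ 2 * Hzzz) * ys i * ys k * ys l
     - s / u ^+ 2 * (Hz + z * Hzz) * cyc (fun i k l => d k l * ys i) i k l
     - 1 / u ^+ 3 * (Hz + z * Hzz)
       * (xs l * ys k * ys i + xs k * ys l * ys i)
     + 1 / u * Hz * (xs l * d i k + xs k * d i l)
     + 1 / u ^+ 3 * (Wz - z * Wzz - z ^+ 2 * Wzzz) * xs i * ys k * ys l
     - 1 / u * (Wz - z * Wzz) * xs i * d k l)
  /\
  (forall i j k l : 'I_n, B (t i) (t j) (t k) (t l) =
     s / u ^+ 5 * (- 15 * z * Hz - 9 * z ^+ 2 * Hzz - z ^+ 3 * Hzzz)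
       * ys i * ys j * ys k * ys l
     + (3 * z * Hz + z ^+ 2 * Hzz)
       * cyc (fun j k l =>
           1 / u ^+ 4 * ys i * xs j * ys k * ys l
           + s / u ^+ 3 * d i j * ys k * ys l
           + s / u ^+ 3 * d j l * ys k * ys i) j k l
     - 1 / u ^+ 2 * z * Hz
       * cyc (fun j k l =>
           (xs j * ys i + u * s * d i j) * d k l
           + (xs j * d i k + xs k * d i j) * ys l) j k l
     - 1 / u ^+ 4 * (3 * z * Wz - 3 * z ^+ 2 * Wzz - z ^+ 3 * Wzzz)
       * xs i * ys j * ys k * ys l
     + z / u ^+ 2 * (Wz - z * Wzz) * xs i
       * cyc (fun j k l => ys j * d k l) j k l).
Proof.
have u0 : enorm (spat y) != 0 by rewrite gt_eqF ?enorm_gt0.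
cbv zeta; rewrite -/(slope y).
have B := berwald_spherical hn hF hFphi hxM hx hy.
have y_coord i : y 0 (lift ord0 i) = spat y 0 i by rewrite mxE.
(* Each component is an identity in u, z, <x,y> and the derivatives of E, H, W;
   all of these become variables, since the field tactic would otherwise try to
   unfold them.  The terms built on z and u are generalized before z and u. *)
do 7?split; [|move=> l|move=> k l|move=> j k l
  |move=> i|move=> i l|move=> i k l|move=> i j k l];
  rewrite B /jet_spray ?unlift_none ?liftK /cyc /= !directionE ?y_coord;
  generalize u0;
  generalize (dz (dz (dz (funE phi))) (slope y) (enorm (spat x)))
    (dz (dz (funE phi)) (slope y) (enorm (spat x)))
    (dz (funE phi) (slope y) (enorm (spat x)))
    (funE phi (slope y) (enorm (spat x)))
    (dz (dz (dz (funH phi))) (slope y) (enorm (spat x)))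
    (dz (dz (funH phi)) (slope y) (enorm (spat x)))
    (dz (funH phi) (slope y) (enorm (spat x)))
    (funH phi (slope y) (enorm (spat x)))
    (dz (dz (dz (funW phi))) (slope y) (enorm (spat x)))
    (dz (dz (funW phi)) (slope y) (enorm (spat x)))
    (dz (funW phi) (slope y) (enorm (spat x)))
    (funW phi (slope y) (enorm (spat x)));
  generalize (slope y) (edot (spat x) (spat y)) (enorm (spat y)); clear.
- by move=> *; field.
- by move=> *; field.
- by move=> *; field.
- by rewrite ?(kronC R l j) ?(kronC R l k) ?(kronC R k j) => *; field.
- by move=> *; field.
- by move=> *; field.
- by rewrite ?(kronC R l i) ?(kronC R l k) ?(kronC R k i) => *; field.
- by rewrite ?(kronC R l j) ?(kronC R l k) ?(kronC R k j) => *; field.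
Qed.
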